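(* Let $G$ be a finite simple graph of maximum degree at most $4$. Then \[ \nu_s(G)\geq \frac{n(G)-i(G)-n_5(G)}{9}, \] where $n(G)$ is the number of vertices of $G$, $i(G)$ is the number of isolated vertices of $G$, and $n_5(G)$ is the number of connected components of $G$ that are isomorphic to $C_5^2$.
   Context: An induced matching of a graph $G$ is a set $M$ of edges of $G$ such that no two edges of $M$ share an endvertex and no edge of $G$ joins an endvertex of one edge of $M$ to an endvertex of another edge of $M$. The strong matching number (induced matching number) $\nu_s(G)$ is the maximum size of an induced matching of $G$. The graph $C_5^2$ is the graph on $10$ vertices obtained from a $5$-cycle $x_1x_2x_3x_4x_5x_1$ by replacing each vertex $x_j$ by an independent set $X_j$ of two vertices, and joining every vertex of $X_j$ to every vertex of $X_{j+1}$ (indices modulo $5$); it is $4$-regular. *)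

(* Defs.v *)
(* A finite simple graph is a symmetric irreflexive relation
   [e : rel T] on a finite type [T] of vertices. *)
From mathcomp Require Import all_boot all_order all_algebra.
Set Implicit Arguments.
Unset Strict Implicit.
Unset Printing Implicit Defensive.

Section Graph.
Variables (T : finType) (e : rel T).

Definition neighbors (x : T) : {set T} := [set y | e x y].

Definition max_degree : nat := \max_(x : T) #|neighbors x|.

Definition edges : {set {set T}} := [set [set x; y] | x in [set: T], y in neighbors x].

Definition induced_matching (M : {set {set T}}) : bool :=
  (M \subset edges) &&
  [forall A in M, forall B in M, (A != B) ==>
     [disjoint A & B] && [forall x in A, forall y in B, ~~ e x y]].

Definition strong_matching_number : nat :=
  \max_(M : {set {set T}} | induced_matching M) #|M|.

Definition isolated_vertices : {set T} := [set x | neighbors x == set0].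

(* Meant for a symmetric [e], for which [connect e] is an equivalence. *)
Definition components : {set {set T}} :=
  equivalence_partition (connect e) [set: T].

(* The subgraph induced by [C] is isomorphic to the graph [h] on [U]. *)
Definition induces_copy_of (U : finType) (h : rel U) (C : {set T}) : bool :=
  [exists f : {ffun U -> T},
     [&& injectiveb f, f @: [set: U] == C
       & [forall u, forall v, e (f u) (f v) == h u v]]].

End Graph.

(* The graph C_5^2: the vertices (j, a), for a in 'I_2, form the independent
   set X_j, and [ordS] is the cyclic successor on 'I_5. *)
Definition C5_2 : rel ('I_5 * 'I_2) :=
  fun u v => (v.1 == ordS u.1) || (u.1 == ordS v.1).

Definition C5_2_components (T : finType) (e : rel T) : {set {set T}} :=
  [set C in components e | induces_copy_of e C5_2 C].

(* Main.v *)
Require Import Defs.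
From mathcomp Require Import all_boot all_order all_algebra.
Set Implicit Arguments.
Unset Strict Implicit.
Unset Printing Implicit Defensive.

(** Call the union R of the neighbourhoods of the ends of an edge uv its
    region, and W the set of vertices that become isolated when R is deleted.
    Adding uv to an induced matching of G - R gives an induced matching of G,
    and deletions create no component C_5^2 because such a component is
    4-regular. Hence in a counterexample with as few non-isolated vertices as
    possible |R| + |W| >= 10 for every edge, whereas |R| <= 8, and no component
    is C_5^2. These conditions are already contradictory locally: a case
    analysis that alternately explores the neighbourhood of a vertex and the
    neighbourhood of a further vertex of W, starting from a vertex of degree d,
    excludes d = 1, 2, 3, 4 in this order. The case analysis, with 133 inner
    nodes, is checked by reflection. *)

(** * Partial graphs and their refutation *)

(* Row [i] lists the neighbours of vertex [i] known so far; its flag records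
   that there are no others. *)
Definition pgraph := seq (bool * seq nat).

Definition explored (s : pgraph) i := (nth (false, [::]) s i).1.
Definition nbrs (s : pgraph) i := (nth (false, [::]) s i).2.

(** Tested anew at every node of a refutation, so that no proof that [attach] preserves it is called
    for. *)
Definition wf_pgraph (s : pgraph) :=
  all (fun i => uniq (nbrs s i) &&
    all (fun j => (j < size s) && (i \in nbrs s j)) (nbrs s i)) (iota 0 (size
      s)).

(* Vertex [c] receives the further neighbours [X] and [k] new ones, and no
   others. *)
Definition attach (s : pgraph) c (X : seq nat) k : pgraph :=
  let n := size s in
  mkseq (fun i =>
    if i == c then (true, nbrs s c ++ X ++ iota n k)
    else (explored s i,
          if (i \in X) || (n <= i) then c :: nbrs s i else nbrs s i)) (n + k).

(** As degrees are at most 4, four known neighbours are all the neighbours. *)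
Definition saturate (s : pgraph) : pgraph :=
  [seq (r.1 || (3 < size r.2), r.2) | r <- s].

Fixpoint subs m (A : seq nat) : seq (seq nat) :=
  if A isn't a :: A' then [:: [::]] else
  (if m is m'.+1 then map (cons a) (subs m' A') else [::]) ++ subs m A'.

(* All ways to complete the neighbourhood of [c] with vertices of [A] and a
   number of new vertices taken from [ks], in a graph without vertices of
   degree strictly between 0 and [d]. *)
Definition extensions d s c A ks : seq pgraph :=
  let n := size (nbrs s c) in
  flatten [seq [seq attach s c X k | k <- ks & d <= n + size X + k <= 4]
          | X <- subs (4 - n) A].

(** Free of repetitions when the rows are, so that its size is |R| once [u] and [v] are explored. *)
Definition region s u v : seq nat :=
  nbrs s u ++ [seq i <- nbrs s v | i \notin nbrs s u].

(* The vertices that may become isolated when the vertices of [r] are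
   deleted. *)
Definition isolable s (r : seq nat) : seq nat :=
  [seq i <- iota 0 (size s) | (i \notin r) && all [in r] (nbrs s i)].

Definition unexplored_in s (r : seq nat) : seq nat :=
  [seq i <- r | ~~ explored s i].

(** A vertex isolated by deleting [r] has no neighbour outside [r], whence [[:: 0]], and no explored
    neighbour that does not already list it. *)
Definition isolations d s (r : seq nat) c : seq pgraph :=
  extensions d s c [seq i <- unexplored_in s r | i \notin nbrs s c] [:: 0].

Inductive step := Explore of nat | Isolate of nat & nat.

(* [Explore c] branches over the neighbourhoods of [c]; [Isolate u v] branches
   over the neighbourhoods of one more vertex isolated by deleting the
   neighbourhood of the edge [uv]. An inapplicable step yields [s] itself, so
   that the children always cover the realizations of [s]. *)
Definition children d s (a : step) : seq pgraph :=
  match a with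
  | Explore c =>
      if ~~ explored s c && (0 < size (nbrs s c)) then
        extensions d s c [seq i <- iota 0 (size s) |
          [&& ~~ explored s i, i != c & i \notin nbrs s c]] (iota 0 5)
      else [:: s]
  | Isolate u v =>
      let r := region s u v in
      let iso := isolable s r in
      if [&& explored s u, explored s v, v \in nbrs s u
           & size r + size (filter (explored s) iso) < 10] then
        flatten [seq isolations d s r c | c <- iso & ~~ explored s c] ++
        isolations d (rcons s (false, [::])) r (size s)
      else [:: s]
  end.

(* Every vertex isolated by deleting [region s u v], and not yet in [s], takes
   up [d] of the free places at the unexplored vertices of the region. *)
Definition deficient d s (uv : nat * nat) :=
  let r := region s uv.1 uv.2 in
  d * (size r + size (isolable s r)) +
    sumn [seq 4 - size (nbrs s i) | i <- unexplored_in s r] < 10 * d.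

(** The region of an edge is completely known only if both ends are explored. *)
Definition explored_edges s : seq (nat * nat) :=
  [seq (u, v) | u <- [seq u <- iota 0 (size s) | explored s u],
                v <- [seq v <- nbrs s u | explored s v]].

(** Unexplored vertices of [p] may have further neighbours in [s], explored ones may not. *)
Definition is_embedding (p s : pgraph) (f : seq nat) :=
  [&& size f == size p, all (gtn (size s)) f, uniq f
    & all (fun i => let w := nth 0 f i in
        let l := map (nth 0 f) (nbrs p i) in
        [&& all (gtn (size p)) (nbrs p i), all [in nbrs s w] l
          & explored p i ==> explored s w && all [in l] (nbrs s w)])
      (iota 0 (size p))].

(* Nested conditionals and [find] because [vm_compute] evaluates both
   arguments of [&&] and all of [has]. *)
Definition compatible s (c : bool) (l l' f : seq nat) w :=
  if w \in f then false else
  if c then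
    if explored s w then
      if size (nbrs s w) == size l then all (fun y => w \in nbrs s y) l'
      else false
    else false
  else if size l <= size (nbrs s w) then all (fun y => w \in nbrs s y) l'
  else false.

(* Not verified: [is_embedding] checks the result. *)
Fixpoint search (s : pgraph) (f : seq nat) (p : pgraph) : seq nat :=
  if p isn't (c, l) :: p' then f else
  let l' := [seq nth 0 f j | j <- l & j < size f] in
  let fix go ws :=
    if ws is w :: ws' then
      if compatible s c l l' f w then
        if search s (rcons f w) p' is i :: f' then i :: f' else go ws'
      else go ws'
    else [::] in
  go (if l' is w :: _ then nbrs s w else iota 0 (size s)).

Definition embeds s p :=
  if search s [::] p is i :: f then is_embedding p s (i :: f) else false.

(** A leaf fails either because some explored edge would have |R| + |W| < 10, or because it contains
    a partial graph already refuted. *)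
Definition refuted_by d (known : seq pgraph) s :=
  let E := explored_edges s in
  if find (deficient d s) E < size E then true
  else find (embeds s) known < size known.

(* Depth-first refutation of [s]: the steps are consumed in prefix order, and
   every refuted partial graph is added to [known]. *)
Fixpoint refute d fuel (st : seq step * seq pgraph) s :
    option (seq step * seq pgraph) :=
  if ~~ wf_pgraph s then None else
  let s := saturate s in
  if refuted_by d st.2 s then Some st else
  match fuel, st.1 with
  | fuel'.+1, a :: steps =>
      omap (fun st' => (st'.1, s :: st'.2))
        (foldl (fun o s' => obind (fun st' => refute d fuel' st' s') o)
           (Some (steps, st.2)) (children d s a))
  | _, _ => None
  end.

Definition star d : pgraph := (true, iota 1 d) :: nseq d (false, [:: 0]).

(* Vertex [(j, a)] of C_5^2 is numbered [2 j + a]. *)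
Definition C5_2_pgraph : pgraph :=
  mkseq (fun i =>
    let b := ((i./2 + 1) %% 5).*2 in let a := ((i./2 + 4) %% 5).*2 in
    (true, [:: b; b.+1; a; a.+1])) 10.

(** Refuting [star d] excludes degree [d], so that the next star may assume minimum degree [d.+1].
    The fuel 10 bounds the depth of a refutation tree. *)
Fixpoint check_stars d (certs : seq (seq step)) (known : seq pgraph) :=
  if certs isn't c :: certs' then true else
  if refute d 10 (c, known) (star d) is Some st
  then check_stars d.+1 certs' st.2 else false.

(* Found by a computer search preferring, at each partial graph, the step that
   leaves the fewest children to refute. *)
Definition certificate : seq (seq step) :=
  [:: [:: Explore 1; Isolate 0 1; Explore 2; Isolate 2 4; Isolate 0 1;
          Isolate 0 1; Isolate 0 1; Explore 2; Isolate 2 6; Isolate 0 1;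
          Isolate 0 1; Explore 2; Isolate 0 1; Isolate 0 1; Isolate 0 1;
          Isolate 0 1; Isolate 0 1; Explore 4; Explore 2; Isolate 0 1;
          Isolate 0 1; Explore 3; Explore 2; Isolate 0 1; Isolate 0 1;
          Explore 3; Isolate 0 1; Explore 4; Isolate 0 1; Explore 2;
          Isolate 0 1; Isolate 0 1; Isolate 0 1; Isolate 0 1; Isolate 0 1];
      [:: Explore 1; Explore 2; Explore 5; Isolate 0 2; Isolate 1 4;
          Isolate 1 4; Explore 7; Isolate 0 1; Isolate 0 2; Isolate 0 2;
          Isolate 0 1; Isolate 0 2; Isolate 0 2; Isolate 1 4; Explore 6;
          Isolate 0 1; Isolate 0 2; Isolate 2 8; Isolate 0 1; Explore 4;
          Isolate 0 1; Isolate 0 2; Explore 6; Isolate 0 1; Isolate 0 2;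
          Isolate 0 2; Isolate 0 1; Isolate 0 1; Explore 3; Isolate 0 1;
          Isolate 0 2; Explore 6; Explore 6];
      [:: Explore 1; Isolate 0 1; Explore 2; Isolate 2 6; Isolate 2 6;
          Isolate 0 1; Explore 2; Isolate 2 7; Isolate 0 1; Isolate 0 2;
          Isolate 2 7; Isolate 0 2; Isolate 0 1; Isolate 2 7; Explore 3;
          Isolate 0 1; Explore 4; Explore 2; Isolate 1 4; Isolate 4 7;
          Isolate 1 4; Isolate 4 7; Explore 2; Explore 2; Explore 3;
          Isolate 0 1; Isolate 0 3; Explore 2; Isolate 0 2; Explore 2;
          Isolate 0 3; Isolate 0 3; Explore 2; Isolate 2 7; Isolate 2 7;
          Isolate 0 1; Isolate 0 1; Explore 4];
      [:: Explore 1; Isolate 0 1; Isolate 0 1; Isolate 0 1; Explore 2;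
          Isolate 0 1; Explore 5; Isolate 5 8; Isolate 5 8; Isolate 1 5;
          Isolate 5 8; Isolate 2 8; Isolate 2 8; Isolate 1 5; Isolate 5 8;
          Isolate 1 5; Isolate 0 1; Explore 2; Isolate 0 2; Isolate 5 8;
          Isolate 2 8; Isolate 4 7; Isolate 2 8; Isolate 2 8; Isolate 2 8;
          Isolate 0 1; Isolate 0 1]].

(** The list of refuted partial graphs starts with C_5^2, which minimality excludes by a separate
    argument. *)
Lemma certificate_ok : check_stars 1 certificate [:: C5_2_pgraph].
Proof. by vm_cast_no_check (erefl true). Qed.

(** * Soundness of the refutation *)

Lemma wf_pgraphP s i : wf_pgraph s -> i < size s ->
  uniq (nbrs s i) /\
  (forall j, j \in nbrs s i -> j < size s /\ i \in nbrs s j).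
Proof.
move=> /allP wf_s lt_i.
have /wf_s/andP[un_i /allP nb_i] : i \in iota 0 (size s) by rewrite mem_iota.
by split=> // j /nb_i/andP.
Qed.

Lemma explored_lt s i : explored s i -> i < size s.
Proof. by rewrite ltnNge; apply: contraL => le_s;
  rewrite /explored nth_default. Qed.

Lemma nbrs_saturate s i : nbrs (saturate s) i = nbrs s i.
Proof.
have [lt_i|le_s] := ltnP i (size s); first by rewrite /nbrs (nth_map (false,
  [::])).
by rewrite /nbrs !nth_default ?size_map.
Qed.

Lemma explored_saturate s i :
  explored (saturate s) i = explored s i || (3 < size (nbrs s i)).
Proof.
have [lt_i|le_s] := ltnP i (size s).
  by rewrite /explored (nth_map (false, [::])).
by rewrite /explored /nbrs !nth_default ?size_map.
Qed.

Lemma size_attach s c X k : size (attach s c X k) = size s + k.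
Proof. exact: size_mkseq. Qed.

Lemma nbrs_attach s c X k i : i < size s + k ->
  nbrs (attach s c X k) i =
    if i == c then nbrs s c ++ X ++ iota (size s) k
    else if (i \in X) || (size s <= i) then c :: nbrs s i else nbrs s i.
Proof. by move=> lt_i; rewrite /nbrs nth_mkseq //; case: eqP. Qed.

Lemma explored_attach s c X k i : i < size s + k ->
  explored (attach s c X k) i = (i == c) || explored s i.
Proof. by move=> lt_i; rewrite /explored nth_mkseq //; case: eqP. Qed.

Lemma filter_in_subs m (a : pred nat) A :
  size (filter a A) <= m -> filter a A \in subs m A.
Proof.
elim: A m => [|i A IH] m //=; case: (a i) => /=; last first.
  by move=> /IH A_m; rewrite mem_cat A_m orbT.
case: m => // m; rewrite ltnS => /IH A_m.
by rewrite mem_cat map_f.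
Qed.

(** * Realizations of partial graphs in a graph of maximum degree at most 4 *)

Section Realizations.

Variables (T : finType) (e : rel T) (x0 : T).
Hypotheses (e_sym : symmetric e) (e_irr : irreflexive e).
Hypothesis deg_le4 : forall y, #|neighbors e y| <= 4.

Local Notation N := (neighbors e).

Lemma in_neighbors y z : (z \in N y) = e y z.
Proof. by rewrite inE. Qed.

(** Two unexplored vertices that do not list each other may still be adjacent in the graph. *)
Definition realizes (x : seq T) (s : pgraph) :=
  [/\ uniq x, size x = size s & forall i, i < size s ->
    (forall j, j \in nbrs s i -> e (nth x0 x i) (nth x0 x j)) /\
    (explored s i -> forall y, e (nth x0 x i) y ->
       y \in map (nth x0 x) (nbrs s i))].

Section OneRealization.

Variables (x : seq T) (s : pgraph).
Hypotheses (x_s : realizes x s) (wf_s : wf_pgraph s).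

Local Notation "''x_' i" := (nth x0 x i) (at level 8, i at level 2, format "''x_' i").

Lemma realizes_inj : {in gtn (size s) &, injective (nth x0 x)}.
Proof.
have [un_x <- _] := x_s => i j lt_i lt_j /eqP.
by rewrite nth_uniq // => /eqP.
Qed.

Lemma realizes_nbr i j : i < size s -> j \in nbrs s i -> e 'x_i 'x_j.
Proof. by have [_ _ H] := x_s => /H[He _] /He. Qed.

Lemma nbrs_lt i j : i < size s -> j \in nbrs s i -> j < size s.
Proof. by move=> lt_i; have [_ H] := wf_pgraphP wf_s lt_i => /H[]. Qed.

Lemma nbrs_sym i j : i < size s -> j \in nbrs s i -> i \in nbrs s j.
Proof. by move=> lt_i; have [_ H] := wf_pgraphP wf_s lt_i => /H[]. Qed.

Lemma uniq_nbrs i : uniq (nbrs s i).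
Proof.
have [/(wf_pgraphP wf_s)[]//|le_s] := ltnP i (size s).
by rewrite /nbrs nth_default.
Qed.

Lemma realizes_explored i j : explored s i -> j < size s ->
  e 'x_i 'x_j -> j \in nbrs s i.
Proof.
move=> ex_i lt_j eij; have lt_i := explored_lt ex_i.
have [_ _ /(_ i lt_i)[_ /(_ ex_i _ eij)]] := x_s.
case/mapP=> k k_i /realizes_inj ->//; rewrite inE.
exact: nbrs_lt k_i.
Qed.

Lemma uniq_image l : uniq l -> {in l, forall i, i < size s} ->
  uniq (map (nth x0 x) l).
Proof.
move=> un_l lt_l; rewrite map_inj_in_uniq // => i j il jl.
by apply: realizes_inj; rewrite inE lt_l.
Qed.

Lemma size_nbrs i : i < size s -> size (nbrs s i) <= #|N 'x_i|.
Proof.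
move=> lt_i; rewrite -(size_map (nth x0 x)).
rewrite cardE uniq_leq_size ?uniq_image ?uniq_nbrs //.
  by move=> j; apply: nbrs_lt.
by move=> _ /mapP[j j_i ->]; rewrite mem_enum inE; apply: realizes_nbr.
Qed.

Lemma explored_neighbors i : explored s i ->
  N 'x_i =i map (nth x0 x) (nbrs s i).
Proof.
move=> ex_i y; have lt_i := explored_lt ex_i; rewrite inE.
apply/idP/idP => [|/mapP[j j_i ->]]; last exact: realizes_nbr.
by have [_ _ /(_ i lt_i)[_ H]] := x_s => /H->.
Qed.

Lemma mem_image_index y : y \in x -> exists2 i, i < size s & y = 'x_i.
Proof.
by have [_ <- _] := x_s => /(nthP x0)[i lt_i <-]; exists i.
Qed.

Lemma mem_map_image i (l : seq nat) : i < size s ->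
  {in l, forall j, j < size s} -> ('x_i \in map (nth x0 x) l) = (i \in l).
Proof.
move=> lt_i lt_l; apply/idP/idP => [/mapP[j jl]|]; last exact: map_f.
by move/realizes_inj => ->//; rewrite inE lt_l.
Qed.

End OneRealization.

Lemma realizes_saturate x s : wf_pgraph s ->
  realizes x s -> realizes x (saturate s).
Proof.
move=> wf_s x_s; have [un_x sz_x H] := x_s.
split=> //; rewrite ?size_map // => i lt_i.
rewrite nbrs_saturate explored_saturate; have [Hi ex_i] := H i lt_i.
split=> // /orP[/ex_i//|gt3] y eiy.
pose l := map (nth x0 x) (nbrs s i).
have un_l : uniq l by apply: (uniq_image x_s); rewrite ?uniq_nbrs // => j;
  apply: nbrs_lt.
have sub_l : {subset l <= enum (N (nth x0 x i))}.
  by move=> _ /mapP[j j_i ->]; rewrite mem_enum inE Hi.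
have [|_ l_N] := uniq_min_size un_l sub_l; last by rewrite l_N mem_enum inE.
by rewrite -cardE size_map (leq_trans (deg_le4 _)).
Qed.

(** The unlisted neighbours of [c] in [x] form the sublist [X] of [A]; those outside [x] are
    appended to [x] as the [k] new vertices. *)
Lemma extension_realizes d x s c A ks :
    realizes x s -> wf_pgraph s -> c < size s ->
    d <= #|N (nth x0 x c)| -> uniq A ->
    {in A, forall i, i < size s /\ i \notin nbrs s c} ->
    (forall i, i < size s -> e (nth x0 x c) (nth x0 x i) ->
       (i \in nbrs s c) || (i \in A)) ->
    #|N (nth x0 x c) :\: [set y in x]| \in ks ->
  exists x' s', s' \in extensions d s c A ks /\ realizes x' s'.
Proof.
move=> x_s wf_s lt_c le_d un_A A_P nb_c k_ks.
have [un_x sz_x H] := x_s; have [un_c c_P] := wf_pgraphP wf_s lt_c.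
pose X := [seq i <- A | e (nth x0 x c) (nth x0 x i)].
pose ys := enum (N (nth x0 x c) :\: [set y in x]).
set k := #|_| in k_ks; have sz_ys : size ys = k by rewrite /ys -cardE.
have ysP y : (y \in ys) = e (nth x0 x c) y && (y \notin x).
  by rewrite mem_enum !inE andbC.
have XP i : i \in X -> [/\ i < size s,
  i \notin nbrs s c & e (nth x0 x c) (nth x0 x i)].
  by rewrite mem_filter => /andP[eci /A_P[]].
have lt_cX i : i \in nbrs s c ++ X -> i < size s.
  by rewrite mem_cat => /orP[/c_P[]//|/XP[]].
have un_cX : uniq (nbrs s c ++ X).
  rewrite cat_uniq un_c filter_uniq // andbT.
  by apply/hasPn => i /XP[].
have N_c : N (nth x0 x c) =i map (nth x0 x) (nbrs s c ++ X) ++ ys.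
  move=> y; rewrite inE mem_cat ysP; apply/idP/orP => [ecy|[]];
    last by case/andP.
    case: (boolP (y \in x)) => [/(mem_image_index x_s)[i lt_i def_y]|_];
      last by right; rewrite ecy.
    left; rewrite def_y map_f // mem_cat mem_filter.
    by rewrite def_y in ecy; rewrite ecy; apply: nb_c.
  by case/mapP=> i; rewrite mem_cat =>
    /orP[/(realizes_nbr x_s lt_c)|/XP[_ _]] + ->.
have un_N : uniq (map (nth x0 x) (nbrs s c ++ X) ++ ys).
  rewrite cat_uniq (uniq_image x_s) // enum_uniq andbT.
  apply/hasPn => y; rewrite ysP => /andP[_]; apply: contraNN.
  by case/mapP => i /lt_cX lt_i ->; rewrite mem_nth ?sz_x.
have card_N : #|N (nth x0 x c)| = size (nbrs s c) + size X + k.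
  by rewrite (eq_card N_c) (card_uniqP un_N) size_cat size_map size_cat sz_ys.
exists (x ++ ys), (attach s c X k); split.
  apply/flatten_mapP; exists X.
    apply: filter_in_subs; rewrite leq_subRL.
      by apply: leq_trans (deg_le4 (nth x0 x c)); rewrite card_N leq_addr.
    exact: leq_trans (size_nbrs x_s wf_s lt_c) (deg_le4 _).
  by apply: map_f; rewrite mem_filter k_ks -card_N le_d deg_le4.
have nth_old i : i < size s -> nth x0 (x ++ ys) i = nth x0 x i.
  by move=> lt_i; rewrite nth_cat sz_x lt_i.
have nth_new i : size s <= i < size s + k -> e (nth x0 x c) (nth x0 (x ++ ys)
  i).
  case/andP=> le_i lt_i; rewrite nth_cat sz_x ltnNge le_i /=.
  have: nth x0 ys (i - size s) \in ys by rewrite mem_nth // sz_ys ltn_subLR.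
  by rewrite ysP => /andP[].
have old_new j : j < size s -> j < size s + k by move/leq_trans->;
  rewrite ?leq_addr.
have c_nb i : i < size s + k -> i \in nbrs s c ++ X ++ iota (size s) k ->
    e (nth x0 (x ++ ys) c) (nth x0 (x ++ ys) i).
  move=> lt_i; rewrite nth_old // catA mem_cat => /orP[i_cX|].
    have lt_i' := lt_cX i i_cX; rewrite nth_old //.
    by move: i_cX; rewrite mem_cat => /orP[/(realizes_nbr x_s lt_c)|/XP[]].
  by rewrite mem_iota => /nth_new.
split.
- rewrite cat_uniq un_x enum_uniq andbT; apply/hasPn => y.
  by rewrite ysP => /andP[].
- by rewrite size_cat size_attach sz_ys sz_x.
rewrite size_attach => i lt_i; rewrite nbrs_attach // explored_attach //.
case: eqP => [->|/eqP ne_ic] /=.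
  split=> [j j_c|_ y]; first apply: c_nb => //.
    move: j_c; rewrite catA mem_cat mem_iota =>
      /orP[/lt_cX/old_new//|/andP[]//].
  rewrite nth_old // -in_neighbors N_c mem_cat => /orP[/mapP[j j_cX ->]|y_ys].
    by rewrite -nth_old ?lt_cX // map_f // catA mem_cat j_cX.
  have lt_y : index y ys < k by rewrite -sz_ys index_mem.
  have -> : y = nth x0 (x ++ ys) (size s + index y ys).
    by rewrite nth_cat sz_x ltnNge leq_addr /= addKn nth_index.
  by rewrite map_f // !mem_cat mem_iota leq_addr ltn_add2l lt_y !orbT.
split=> [j|ex_i y].
  have old_j : j \in nbrs s i -> e (nth x0 (x ++ ys) i) (nth x0 (x ++ ys) j).
    move=> j_i; have [lt_i'|le_i] := ltnP i (size s).
      have lt_j := nbrs_lt wf_s lt_i' j_i.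
      by rewrite !nth_old //; apply: realizes_nbr j_i.
    by move: j_i; rewrite /nbrs nth_default.
  case: ifP => // iX; rewrite in_cons => /orP[/eqP->|//]; rewrite e_sym c_nb //.
  rewrite !mem_cat mem_iota lt_i andbT; case/orP: iX => ->; rewrite ?orbT //.
have lt_i' := explored_lt ex_i; rewrite nth_old // => eiy.
have /mapP[j j_i def_y] : y \in map (nth x0 x) (nbrs s i).
  by have [_ Hi] := H i lt_i'; apply: Hi.
rewrite def_y -nth_old ?(nbrs_lt wf_s lt_i' j_i) //.
by apply: map_f; case: ifP; rewrite // in_cons j_i orbT.
Qed.

(** * The sets R and W of an edge, and the children of a partial graph *)

Definition edge_region u v : {set T} := N u :|: N v.

Definition newly_isolated u v : {set T} :=
  [set w | [&& w \notin edge_region u v,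
    N w != set0 & N w \subset edge_region u v]].

(** Serves to count, from both sides, the edges between a region and vertices that its deletion
    isolates. *)
Lemma sum_adjacent (A : {set T}) z : \sum_(w in A) e w z = #|A :&: N z|.
Proof.
rewrite -sum1_card [RHS](eq_bigl [pred w | (w \in A) && e w z]) => [|w];
  last first.
  by rewrite in_setI in_neighbors e_sym.
by rewrite big_mkcondr; apply: eq_bigr => w _; case: e.
Qed.

(** This is what the minimality of a counterexample provides; it is established within
    [nonisolated_le]. *)
Hypothesis loss_ge10 : forall u v, e u v ->
  10 <= #|edge_region u v| + #|newly_isolated u v|.

Section MinDegree.

Variable d : nat.
Hypothesis deg_ge : forall y, N y != set0 -> d <= #|N y|.

Lemma isolation_realizes x s r c :
    realizes x s -> wf_pgraph s -> c < size s -> uniq r ->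
    {in r, forall i, i < size s} ->
    N (nth x0 x c) != set0 ->
    N (nth x0 x c) \subset [set y in map (nth x0 x) r] ->
  exists x' s', s' \in isolations d s r c /\ realizes x' s'.
Proof.
move=> x_s wf_s lt_c un_r lt_r Nc0 /subsetP Nc_r.
apply: (extension_realizes x_s) => //; first exact: deg_ge.
- by rewrite !filter_uniq.
- by move=> i; rewrite !mem_filter => /and3P[? _ /lt_r].
- move=> i lt_i eci; rewrite !mem_filter.
  have: nth x0 x i \in [set y in map (nth x0 x) r] by rewrite Nc_r // inE.
  rewrite inE (mem_map_image x_s) // => ->; rewrite andbT.
  case: (boolP (i \in nbrs s c)) => //= nci; apply: contra nci => ex_i.
  by apply: nbrs_sym (realizes_explored x_s wf_s ex_i lt_c _); rewrite // e_sym.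
rewrite inE cards_eq0 setD_eq0; apply/subsetP => y /Nc_r; rewrite !inE.
have [_ sz_x _] := x_s.
by case/mapP=> i /lt_r lt_i ->; rewrite mem_nth ?sz_x.
Qed.

Section Region.

Variables (x : seq T) (s : pgraph) (u v : nat).
Hypotheses (x_s : realizes x s) (wf_s : wf_pgraph s).
Hypotheses (ex_u : explored s u) (ex_v : explored s v).

Let r := region s u v.
Let R := edge_region (nth x0 x u) (nth x0 x v).
Let W := newly_isolated (nth x0 x u) (nth x0 x v).

Lemma uniq_region : uniq r.
Proof.
rewrite cat_uniq filter_uniq ?uniq_nbrs // andbT.
by apply/hasPn => i; rewrite mem_filter => /andP[].
Qed.

Lemma region_lt : {in r, forall i, i < size s}.
Proof.
move=> i; rewrite mem_cat mem_filter => /orP[|/andP[_]];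
  exact: nbrs_lt (explored_lt _).
Qed.

Lemma region_image : R = [set y in map (nth x0 x) r].
Proof.
apply/setP=> y; rewrite in_setU (explored_neighbors x_s ex_u).
rewrite (explored_neighbors x_s ex_v) inE map_cat mem_cat.
apply/orP/orP => -[|/mapP[i iN ->]]; try by left.
  case: (boolP (i \in nbrs s u)) => i_u; [left | right]; apply: map_f => //.
  by rewrite mem_filter i_u.
by right; apply: map_f; move: iN; rewrite mem_filter => /andP[].
Qed.

Lemma card_region : #|R| = size r.
Proof.
rewrite region_image cardsE -(size_map (nth x0 x)); apply/card_uniqP.
by apply: (uniq_image x_s); [exact: uniq_region | exact: region_lt].
Qed.

(** Listed neighbours are actual neighbours. The converse may fail, as some neighbours need not be
    listed yet. *)
Lemma newly_isolated_isolable i : i < size s -> nth x0 x i \in W ->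
  i \in isolable s r.
Proof.
move=> lt_i; rewrite inE => /and3P[iR _ /subsetP iN].
have rP j : j < size s -> (nth x0 x j \in R) = (j \in r).
  by move=> lt_j; rewrite region_image inE (mem_map_image x_s) //;
    exact: region_lt.
rewrite mem_filter mem_iota lt_i -rP // iR !andbT /=.
apply/allP => j j_i; rewrite /= -rP; last exact: nbrs_lt j_i.
by rewrite iN // inE; apply: realizes_nbr j_i.
Qed.

(** W has at least 10 - |R| members, more than there are explored isolable vertices; hence some
    member [w] of W is unexplored or outside [x]. *)
Lemma isolate_realizes : v \in nbrs s u ->
    size r + size (filter (explored s) (isolable s r)) < 10 ->
  exists x' s', s' \in children d s (Isolate u v) /\ realizes x' s'.
Proof.
move=> v_u lt10; rewrite /children ex_u ex_v v_u lt10.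
have [un_x sz_x H] := x_s.
set I := filter _ _ in lt10.
have /subsetPn[w wW wI] : ~~ (W \subset [set y in map (nth x0 x) I]).
  apply: contraL lt10 => /subset_leq_card W_I; rewrite -leqNgt.
  apply: leq_trans (loss_ge10 (realizes_nbr x_s (explored_lt ex_u) v_u)) _.
  rewrite -/R card_region leq_add2l -(size_map (nth x0 x)).
  by apply: leq_trans W_I _; rewrite cardsE card_size.
have := wW; rewrite inE => /and3P[wR Nw0 NwR].
have [w_x|w_x] := boolP (w \in x).
  have [i lt_i def_w] := mem_image_index x_s w_x.
  rewrite def_w in wW wI Nw0 NwR *.
  have i_iso := newly_isolated_isolable lt_i wW.
  have ex_i : ~~ explored s i.
    by apply: contra wI => ex_i; rewrite inE map_f // mem_filter ex_i.
  have [|x' [s' [s'P x'P]]] := isolation_realizes x_s wf_s lt_i uniq_region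
    region_lt Nw0.
    by rewrite -region_image.
  exists x', s'; split=> //; rewrite mem_cat; apply/orP; left.
  by apply/flatten_mapP; exists i; rewrite // mem_filter ex_i.
(* If [w] is outside [x], it first joins as an unexplored vertex without listed neighbours. *)
pose s1 := rcons s (false, [::]).
have nbrs1 i : nbrs s1 i = nbrs s i by rewrite /nbrs nth_rcons_default.
have explored1 i : explored s1 i = explored s i.
  by rewrite /explored nth_rcons_default.
have nth1 i : i < size s -> nth x0 (rcons x w) i = nth x0 x i.
  by move=> lt_i; rewrite nth_rcons sz_x lt_i.
have nth_w : nth x0 (rcons x w) (size s) = w by rewrite nth_rcons sz_x ltnn
  eqxx.
have nbrs_n : nbrs s (size s) = [::] by rewrite /nbrs nth_default.
have unex_n : explored s (size s) = false by rewrite /explored nth_default.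
have x_s1 : realizes (rcons x w) s1.
  split; first by rewrite rcons_uniq w_x.
    by rewrite !size_rcons sz_x.
  rewrite size_rcons => i; rewrite ltnS leq_eqVlt => /orP[/eqP->|lt_i].
    by rewrite nbrs1 nbrs_n explored1 unex_n; split.
  rewrite nbrs1 explored1 nth1 //.
  have -> : map (nth x0 (rcons x w)) (nbrs s i) = map (nth x0 x) (nbrs s i).
    by apply/eq_in_map => j j_i; rewrite nth1 //; apply: nbrs_lt j_i.
  split=> [j j_i|]; last by have [] := H i lt_i.
  by rewrite nth1 ?(nbrs_lt wf_s lt_i) //; apply: realizes_nbr j_i.
have wf_s1 : wf_pgraph s1.
  apply/allP => i; rewrite mem_iota size_rcons leq0n add0n ltnS leq_eqVlt /=.
  case/orP=> [/eqP->|lt_i]; first by rewrite nbrs1 nbrs_n.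
  have [un_i i_P] := wf_pgraphP wf_s lt_i.
  rewrite nbrs1 un_i; apply/allP => j /i_P[lt_j i_j].
  by rewrite nbrs1 i_j ltnS ltnW.
have lt_r1 : {in r, forall i, i < size s1}.
  by move=> i /region_lt; rewrite size_rcons => /ltnW.
have [|||x' [s' [s'P x'P]]] :=
    @isolation_realizes (rcons x w) s1 r (size s) x_s1 wf_s1 _ uniq_region
      lt_r1.
- by rewrite size_rcons.
- by rewrite nth_w.
- rewrite nth_w; have -> : map (nth x0 (rcons x w)) r = map (nth x0 x) r.
    by apply/eq_in_map => j /region_lt/nth1.
  by rewrite -region_image.
by exists x', s'; rewrite mem_cat s'P orbT.
Qed.

(** The edges between R and the part [W'] of W outside [x] are counted twice: each member of [W']
    has all its neighbours, at least [d], in R. *)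
Lemma sufficient : v \in nbrs s u -> ~~ deficient d s (u, v).
Proof.
move=> v_u; rewrite -leqNgt /= -/r.
have := loss_ge10 (realizes_nbr x_s (explored_lt ex_u) v_u).
rewrite -/R -/W card_region => ge10.
have [un_x sz_x H] := x_s.
pose X := [set y in x]; pose W' := W :\: X.
have W_iso : #|W :&: X| <= size (isolable s r).
  rewrite -(size_map (nth x0 x)); apply: leq_trans (card_size _).
  apply: subset_leq_card; apply/subsetP => y; rewrite in_setI.
  case/andP => yW; rewrite inE => /(mem_image_index x_s)[i lt_i def_y].
  rewrite def_y map_f //; apply: newly_isolated_isolable => //.
  by rewrite -def_y.
have cap_W' : d * #|W'| <= sumn [seq 4 - size (nbrs s i) | i <- unexplored_in s
  r].
  apply: leq_trans (_ : \sum_(w in W') \sum_(z in R) e w z <= _).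
    rewrite mulnC -sum_nat_const; apply: leq_sum => w.
    rewrite 3!inE => /andP[_ /and3P[_ /deg_ge le_d /setIidPr def_Nw]].
    by under eq_bigr do rewrite e_sym; rewrite sum_adjacent def_Nw.
  rewrite exchange_big /= sumnE big_map big_filter.
  have -> : \sum_(z in R) \sum_(w in W') e w z = \sum_(i <- r) \sum_(w in W') e
    w (nth x0 x i).
    rewrite region_image -(big_map (nth x0 x) predT (fun z =>
      \sum_(w in W') e w z)).
    rewrite big_uniq /=; first by apply: eq_bigl => z; rewrite inE.
    by apply: (uniq_image x_s); [exact: uniq_region | exact: region_lt].
  rewrite [leqRHS]big_mkcond /= !big_seq; apply: leq_sum => i /region_lt lt_i.
  have W'_nbr w j : w \in W' -> j \in nbrs s i -> w != nth x0 x j.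
    move=> wW' j_i; apply: contraTneq wW' => ->.
    by rewrite 2!inE mem_nth // sz_x (nbrs_lt wf_s lt_i).
  (* All neighbours of an explored vertex lie in [x], so it contributes nothing. *)
  case: ifPn => [_|]; last first.
    rewrite negbK => ex_i; rewrite big1 // => w wW'.
    apply/eqP; rewrite eqb0 e_sym -in_neighbors (explored_neighbors x_s ex_i).
    by apply/mapP => -[j j_i /eqP]; apply/negP/W'_nbr.
  have un_i : uniq (map (nth x0 x) (nbrs s i)).
    by apply: (uniq_image x_s); rewrite ?uniq_nbrs // => j; apply: nbrs_lt.
  (* Of the at most four neighbours, the listed ones lie in [x] and thus outside [W']. *)
  rewrite leq_subRL; last exact: leq_trans (size_nbrs x_s wf_s lt_i) (deg_le4
    _).
  apply: leq_trans (deg_le4 (nth x0 x i)).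
  have <- : #|[set y in map (nth x0 x) (nbrs s i)]| = size (nbrs s i).
    by rewrite cardsE (card_uniqP un_i) size_map.
  have nb_N : [set y in map (nth x0 x) (nbrs s i)] \subset N (nth x0 x i).
    apply/subsetP => y; rewrite inE => /mapP[j j_i ->].
    by rewrite inE (realizes_nbr x_s).
  rewrite sum_adjacent -leq_subRL ?subset_leq_card // -cardsDS //.
  apply/subset_leq_card/subsetP => w; rewrite in_setI in_setD => /andP[wW' ->].
  by rewrite andbT inE; apply/mapP => -[j j_i /eqP]; apply/negP/W'_nbr.
rewrite mulnC -[leqLHS]/(d * 10); apply: leq_trans (leq_mul (leqnn d) ge10) _.
rewrite -(cardsID X W) -/W' addnA mulnDr leq_add // leq_mul2l leq_add2l W_iso.
by rewrite orbT.
Qed.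

End Region.

Lemma children_realizes x s a : realizes x s -> wf_pgraph s ->
  exists x' s', s' \in children d s a /\ realizes x' s'.
Proof.
move=> x_s wf_s; case: a => [c|u v]; last first.
  have [/and4P[ex_u ex_v v_u lt10]|not_ok] := boolP [&& explored s u,
    explored s v,
      v \in nbrs s u & size (region s u v) +
        size (filter (explored s) (isolable s (region s u v))) < 10].
    exact: (isolate_realizes x_s).
  by exists x, s; rewrite /= (negPf not_ok) inE.
rewrite /children; case: ifP => [/andP[ex_c c_nb]|_]; last first.
  by exists x, s; rewrite inE.
have lt_c : c < size s.
  by move: c_nb; apply: contraLR; rewrite -leqNgt => ?;
    rewrite /nbrs nth_default.
have [j j_c] : exists j, j \in nbrs s c.
  by case: (nbrs s c) c_nb => // j l _; exists j; rewrite mem_head.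
apply: (extension_realizes x_s) => //.
(* The listed neighbour [j] shows that [c] is not isolated, so its degree is at least [d]. *)
- by apply/deg_ge/set0Pn; exists (nth x0 x j); rewrite inE (realizes_nbr x_s).
- by rewrite filter_uniq ?iota_uniq.
- by move=> i; rewrite mem_filter mem_iota => /andP[/and3P[_ _ ->]].
- move=> i lt_i eci; rewrite mem_filter mem_iota leq0n add0n lt_i andbT.
  case: (boolP (i \in nbrs s c)) => //= nci; rewrite andbT; apply/andP; split.
    apply: contra nci => ex_i.
    by apply: nbrs_sym (realizes_explored x_s wf_s ex_i lt_c _);
      rewrite // e_sym.
  by rewrite andbT; apply: contraTneq eci => ->; rewrite e_irr.
(* At most four neighbours lie outside [x], which accounts for [iota 0 5]. *)
rewrite mem_iota ltnS; apply: leq_trans (deg_le4 (nth x0 x c)).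
by rewrite subset_leq_card // subsetDl.
Qed.

(** * Embeddings of partial graphs, and soundness of the tree search *)

Lemma embedding_realizes x p s f :
  realizes x s -> is_embedding p s f -> realizes (map (nth x0 x) f) p.
Proof.
move=> x_s /and4P[/eqP sz_f /allP f_lt un_f /allP f_ok].
have [un_x sz_x H] := x_s.
have nth_f i : i < size p -> nth x0 (map (nth x0 x) f) i = nth x0 x (nth 0 f i).
  by move=> lt_i; rewrite (nth_map 0) ?sz_f.
split; rewrite ?size_map //; first exact: (uniq_image x_s).
move=> i lt_i; have /f_ok : i \in iota 0 (size p) by rewrite mem_iota.
case/and3P=> /allP lt_p /allP f_nbr /implyP f_ex.
have lt_w : nth 0 f i < size s by apply: f_lt; rewrite mem_nth ?sz_f.
rewrite nth_f //; split=> [j j_i|/f_ex/andP[ex_w /allP w_nbr] y ewy].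
  rewrite nth_f; last exact: lt_p.
  by apply: (realizes_nbr x_s lt_w); apply/f_nbr/map_f.
have [_ /(_ ex_w y ewy)/mapP[k /w_nbr/mapP[j j_i ->] ->]] := H _ lt_w.
by rewrite -nth_f ?map_f //; apply: lt_p.
Qed.

(** Independent of [d]: what is refuted for one minimum degree stays available for the next. *)
Definition unrealizable s := forall x, ~ realizes x s.

Lemma wf_saturate s : wf_pgraph (saturate s) = wf_pgraph s.
Proof.
rewrite /wf_pgraph size_map; apply: eq_all => i; rewrite nbrs_saturate.
by congr (_ && _); apply: eq_all => j; rewrite nbrs_saturate.
Qed.

Lemma refuted_by_sound known s : wf_pgraph s ->
    {in known, forall p, unrealizable p} ->
  refuted_by d known s -> unrealizable s.
Proof.
rewrite /refuted_by -!has_find => wf_s known_u ref_s x x_s.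
move: ref_s; case: ifP => [/hasP[[u v]] |_ /hasP[p p_known]].
  case/allpairsPdep=> u' [v' []]; rewrite !mem_filter.
  case/andP=> ex_u _ /andP[ex_v v_u] [-> ->].
  by move=> def_uv _; move: def_uv; apply/negP/(sufficient x_s).
rewrite /embeds; case: search => // i f /(embedding_realizes x_s).
exact: known_u.
Qed.

(** The invariant is that all known partial graphs are unrealizable. A realization of [s] would
    yield one of some child, and every child is refuted. *)
Lemma refute_sound fuel (st : seq step * seq pgraph) s st' :
    {in st.2, forall p, unrealizable p} ->
    refute d fuel st s = Some st' ->
  unrealizable s /\ {in st'.2, forall p, unrealizable p}.
Proof.
elim: fuel st s st' => [|fuel IH] st s st' st_u /=; case: ifPn => //;
  rewrite negbK => wf_s; have wf_s1 : wf_pgraph (saturate s) by rewrite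
    wf_saturate.
  case: ifP => // /(refuted_by_sound wf_s1 st_u) s_u [<-]; split=> // x.
  by move/(realizes_saturate wf_s)/s_u.
have sat_u : unrealizable (saturate s) -> unrealizable s.
  by move=> s_u x /(realizes_saturate wf_s)/s_u.
case: ifP => [/(refuted_by_sound wf_s1 st_u)/sat_u s_u [<-] //|_].
case: st st_u => -[|a steps] known //= known_u.
set s1 := saturate s in wf_s1 sat_u *.
have all_u l (st : seq step * seq pgraph) : {in st.2, forall p,
  unrealizable p} ->
    forall st'', foldl (fun o s' => obind (fun st' =>
      refute d fuel st' s') o) (Some st) l = Some st'' ->
    {in l, forall p, unrealizable p} /\ {in st''.2, forall p, unrealizable p}.
  elim: l st => [|s' l IHl] st st_u st'' /=; first by case=> <-.
  case ref_s': (refute d fuel st s') => [st1|]; last first.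
    (* Once a child fails, the fold stays at [None]. *)
    by move=> none; suff: false by []; elim: l {IHl} none.
  have [s'_u st1_u] := IH _ _ _ st_u ref_s'.
  case/(IHl _ st1_u) => l_u st''_u; split=> // p.
  by rewrite in_cons => /orP[/eqP->|/l_u].
case def_st1: foldl => [st1|] //= [<-].
have [ch_u st1_u] := all_u _ (steps, known) known_u _ def_st1.
have s1_u : unrealizable s1.
  move=> x x_s1; have [x' [s' [/ch_u s'_u /s'_u]]] :=
    children_realizes a x_s1 wf_s1.
  by [].
by split=> [|p]; [exact: sat_u | rewrite in_cons => /orP[/eqP->|/st1_u]].
Qed.

Lemma star_realizes y : #|N y| = d -> realizes (y :: enum (N y)) (star d).
Proof.
move=> sz_N; have sz_e : size (enum (N y)) = d by rewrite -cardE.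
have nbrs0 : map (nth x0 (y :: enum (N y))) (iota 1 d) = enum (N y).
  by rewrite -[1]/(1 + 0) iotaDl -map_comp -sz_e; apply: mkseq_nth.
split.
- by rewrite cons_uniq enum_uniq mem_enum inE e_irr.
- by rewrite /= size_nseq sz_e.
rewrite /= size_nseq => -[|i] lt_i.
  split=> [j j_i|_ z eyz] /=.
    rewrite -in_neighbors -mem_enum -[X in _ \in X]nbrs0.
    exact: (map_f (nth x0 (y :: enum (N y)))).
  by rewrite [map _ _]nbrs0 mem_enum inE.
rewrite /nbrs /explored /= nth_nseq -ltnS lt_i; split=> // j; rewrite inE =>
  /eqP-> /=.
by rewrite e_sym -in_neighbors -mem_enum mem_nth // sz_e.
Qed.

End MinDegree.

(** A vertex of degree [d] followed by its neighbours realizes [star d], so each refuted star raises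
    the minimum degree of the non-isolated vertices by one. *)
Lemma check_stars_sound d certs known :
    {in known, forall p, unrealizable p} ->
    (forall y, N y != set0 -> d <= #|N y|) -> check_stars d certs known ->
  forall y, N y != set0 -> d + size certs <= #|N y|.
Proof.
elim: certs d known => [|c certs IH] d known known_u deg_ge.
  by rewrite addn0.
rewrite /check_stars -/check_stars.
case ref_d: (refute d 10 (c, known) (star d)) => [st|//].
have [star_u st_u] := refute_sound deg_ge (st := (c, known)) known_u ref_d.
rewrite addnS -addSn; apply: IH st_u _ => y Ny.
rewrite ltn_neqAle deg_ge // andbT; apply/eqP => def_d.
by case: (star_u (y :: enum (N y))); apply: star_realizes.
Qed.

Lemma all_isolated : unrealizable C5_2_pgraph -> forall y, N y = set0.
Proof.
move=> C5_u y; apply/eqP; apply: contraT => Ny.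
(* The four certificates leave only degrees at least 1 + 4. *)
have := deg_le4 y; rewrite leqNgt (check_stars_sound _ _ certificate_ok) //.
  by move=> p; rewrite inE => /eqP->.
by move=> z; rewrite card_gt0.
Qed.

(** * A realization of the full partial graph C_5^2 is a component *)

Section C5_2Component.

Variable x : seq T.
Hypothesis x_C5 : realizes x C5_2_pgraph.

Let X := [set y in x].

Lemma C5_2_adjacent i j : i < 10 -> j < 10 ->
  e (nth x0 x i) (nth x0 x j) = (j \in nbrs C5_2_pgraph i).
Proof.
move=> lt_i lt_j; apply/idP/idP; last exact: realizes_nbr.
apply: (realizes_explored x_C5) => //.
by move: i lt_i; do 10?[case=> //].
Qed.

(** All vertices of [C5_2_pgraph] are explored. *)
Lemma C5_2_closed y z : y \in X -> e y z -> z \in X.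
Proof.
rewrite inE => /(mem_image_index x_C5)[i lt_i ->].
rewrite -in_neighbors (explored_neighbors x_C5); last first.
  by move: i lt_i; do 10?[case=> //].
case/mapP=> j j_i ->; have [_ sz_x _] := x_C5.
by rewrite inE mem_nth // sz_x (nbrs_lt _ lt_i).
Qed.

(** Walks of length at most two from vertex 0 reach all of C_5^2. *)
Lemma C5_2_connect i : i < 10 -> connect e (nth x0 x 0) (nth x0 x i).
Proof.
have path2 j k : j < 10 -> k < 10 -> j \in nbrs C5_2_pgraph 0 ->
    k \in nbrs C5_2_pgraph j -> connect e (nth x0 x 0) (nth x0 x k).
  move=> lt_j lt_k j_0 k_j; apply: (@connect_trans _ _ (nth x0 x j));
    by rewrite connect1 ?C5_2_adjacent.
move=> lt_i; have: i \in flatten [seq nbrs C5_2_pgraph j | j <- nbrs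
  C5_2_pgraph 0] ++ nbrs C5_2_pgraph 0.
  by move: i lt_i; do 10?[case=> //].
rewrite mem_cat => /orP[/flatten_mapP[j j_0 i_j]|i_0]; last first.
  by rewrite connect1 ?C5_2_adjacent.
by apply: (path2 j) => //; apply: (nbrs_lt _ _ j_0).
Qed.

Definition C5_2_index (u : 'I_5 * 'I_2) : nat := u.1.*2 + u.2.

Lemma C5_2_index_lt u : C5_2_index u < 10.
Proof.
apply: (@leq_trans (u.1.*2 + 2)); first by rewrite ltn_add2l.
by rewrite addn2 -doubleS -[10]/(5.*2) leq_double.
Qed.

Lemma C5_2_index_inj : injective C5_2_index.
Proof.
move=> [a b] [a' b']; rewrite /C5_2_index /= => eq_ab.
have halfE (i : 'I_5) (j : 'I_2) : (i.*2 + j)./2 = i /\ odd (i.*2 + j) = (j ==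
  1 :> nat).
  by rewrite halfD doubleK oddD odd_double; case: j => [[|[|]]] //=;
    rewrite addn0.
have [ha oa] := halfE a b; have [ha' oa'] := halfE a' b'.
have eq_a : a = a' by apply: val_inj; rewrite /= -ha eq_ab ha'.
by rewrite eq_a in eq_ab *; congr (_, _); apply/val_inj/(addnI eq_ab).
Qed.

Lemma C5_2_indexE u v :
  (C5_2_index v \in nbrs C5_2_pgraph (C5_2_index u)) = C5_2 u v.
Proof.
(* All 100 pairs are checked by computation on numbers instead of ordinals; [i.+1 %% 5] is the value
   of [ordS]. *)
have check : all (fun i => all (fun a => all (fun j => all (fun b =>
    (j.*2 + b \in nbrs C5_2_pgraph (i.*2 + a)) ==
      ((j == i.+1 %% 5) || (i == j.+1 %% 5)))
  (iota 0 2)) (iota 0 5)) (iota 0 2)) (iota 0 5) by [].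
have in_iota n (i : 'I_n) : (i : nat) \in iota 0 n by rewrite mem_iota /=.
have /allP/(_ _ (in_iota _ u.2)) := allP check _ (in_iota _ u.1).
by move=> /allP/(_ _ (in_iota _ v.1))/allP/(_ _ (in_iota _ v.2))/eqP.
Qed.

Lemma C5_2_component : X \in C5_2_components e.
Proof.
have [un_x sz_x _] := x_C5.
rewrite inE; apply/andP; split.
  apply/imsetP; exists (nth x0 x 0) => //; apply/setP => y; rewrite !inE.
  apply/idP/idP => [/(mem_image_index x_C5)[i lt_i ->]|].
    exact: C5_2_connect.
  have cl_X : fingraph.closed e (mem X).
    by apply: (intro_closed (sym_connect_sym e_sym)) => z t ezt /C5_2_closed;
      apply.
  move/(closed_connect cl_X); rewrite !inE => <-.
  by rewrite mem_nth ?sz_x.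
apply/existsP; exists [ffun u => nth x0 x (C5_2_index u)].
apply/and3P; split.
- apply/injectiveP => u v; rewrite !ffunE => /eqP.
  by rewrite nth_uniq ?sz_x ?C5_2_index_lt // => /eqP/C5_2_index_inj.
- rewrite eqEcard; apply/andP; split.
    by apply/subsetP => _ /imsetP[u _ ->];
      rewrite ffunE inE mem_nth // sz_x C5_2_index_lt.
  rewrite card_imset; last first.
    move=> u v; rewrite !ffunE => /eqP.
    by rewrite nth_uniq ?sz_x ?C5_2_index_lt // => /eqP/C5_2_index_inj.
  by rewrite cardsE (card_uniqP un_x) sz_x cardsT card_prod !card_ord.
apply/forallP => u; apply/forallP => v; rewrite !ffunE.
by rewrite C5_2_adjacent ?C5_2_index_lt // C5_2_indexE.
Qed.

End C5_2Component.

End Realizations.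

(** * Deleting the region of an edge *)

Section Deletion.

Variables (T : finType) (e : rel T).
Hypotheses (e_sym : symmetric e) (e_irr : irreflexive e).
Hypothesis deg_le4 : forall y, #|neighbors e y| <= 4.

Local Notation N := (neighbors e).

(* The vertex type is kept: deleted vertices are isolated, hence not counted. *)
Definition delete (R : {set T}) : rel T :=
  fun x y => [&& e x y, x \notin R & y \notin R].

Lemma delete_sym R : symmetric (delete R).
Proof. by move=> x y; rewrite /delete e_sym [(x \notin R) && _]andbC. Qed.

Lemma delete_irr R : irreflexive (delete R).
Proof. by move=> x; rewrite /delete e_irr. Qed.

Lemma neighbors_delete_sub R y : neighbors (delete R) y \subset N y.
Proof. by apply/subsetP => z; rewrite !inE => /and3P[]. Qed.

Lemma neighbors_deleted (R : {set T}) y : y \in R -> neighbors (delete R) y =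
  set0.
Proof. by move=> yR; apply/setP => z; rewrite !inE /delete yR andbF. Qed.

Lemma edgesP (h : rel T) A :
  reflect (exists x y, h x y /\ A = [set x; y]) (A \in edges h).
Proof.
apply: (iffP imset2P) => [[x y _ hxy ->]|[x [y [hxy ->]]]].
  by exists x, y; rewrite inE in hxy.
by exists x y; rewrite ?inE.
Qed.

Lemma strong_matching_delete u v : e u v ->
  strong_matching_number (delete (edge_region e u v)) < strong_matching_number
    e.
Proof.
move=> euv; set R := edge_region e u v; set e' := delete R.
have [uR vR] : u \in R /\ v \in R by rewrite !inE euv e_sym euv orbT.
suff ext M : induced_matching e' M -> #|M| < strong_matching_number e.
  (* The empty matching shows that [strong_matching_number e] is positive, so that the strict bound
     on the maximum can be read as a weak one against its predecessor. *)
  have ind0 : induced_matching e' set0.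
    by rewrite /induced_matching sub0set; apply/forall_inP => A; rewrite inE.
  rewrite -(ltn_predK (ext _ ind0)) ltnS; apply/bigmax_leqP => M /ext.
  by rewrite -{1}(ltn_predK (ext _ ind0)).
case/andP=> /subsetP M_e' M_ind.
have M_R A x : A \in M -> x \in A -> x \notin R.
  by case/M_e'/edgesP => y [z [/and3P[_ yR zR] ->]]; rewrite in_set2 =>
    /orP[]/eqP->.
pose uv := [set u; v].
have uv_R x : x \in uv -> x \in R by rewrite !in_set2 => /orP[]/eqP->.
have uv_far x y : x \in uv -> y \notin R -> ~~ e x y.
  by rewrite !inE negb_or => /orP[]/eqP-> /andP[].
have uvM : uv \notin M.
  by apply: contraL uR => /M_R; apply; rewrite !inE eqxx.
have -> : #|M|.+1 = #|uv |: M| by rewrite cardsU1 uvM.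
apply: leq_bigmax_cond; apply/andP; split.
  apply/subsetP => A; rewrite in_setU1 =>
    /orP[/eqP->|/M_e'/edgesP[x [y [/and3P[exy _ _] ->]]]].
    by apply/edgesP; exists u, v.
  by apply/edgesP; exists x, y.
have uv_ind A : A \in M -> [disjoint uv & A] &&
    [forall x in uv, forall y in A, ~~ e x y].
  move=> AM; apply/andP; split.
    apply/pred0P => x /=; apply/negP => /andP[/uv_R xR /(M_R _ _ AM)].
    by rewrite xR.
  by apply/forall_inP => x x_uv; apply/forall_inP => y /(M_R _ _ AM)/uv_far->.
apply/forall_inP => A; rewrite in_setU1 => AM; apply/forall_inP => B.
rewrite in_setU1 => BM; apply/implyP => neAB.
case/orP: AM => [/eqP defA|AM]; case/orP: BM => [/eqP defB|BM].
- by rewrite defA defB eqxx in neAB.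
- by rewrite defA uv_ind.
- rewrite defB; have /andP[dis far] := uv_ind A AM.
  rewrite disjoint_sym dis; apply/forall_inP => x xA; apply/forall_inP =>
    y y_uv.
  by rewrite e_sym; move/forall_inP/(_ y y_uv)/forall_inP: far; apply.
have /forall_inP/(_ A AM)/forall_inP/(_ B BM)/implyP/(_ neAB)/andP[-> /= far]
  := M_ind.
apply/forall_inP => x xA; apply/forall_inP => y yB.
have /forall_inP/(_ x xA)/forall_inP/(_ y yB) := far.
by rewrite /e' /delete (M_R _ _ AM xA) (M_R _ _ BM yB) !andbT.
Qed.

(** A non-isolated vertex outside R and W has a neighbour outside R, which it keeps. *)
Lemma nonisolated_delete u v : e u v ->
  #|~: isolated_vertices e| <=
    #|~: isolated_vertices (delete (edge_region e u v))| +
      (#|edge_region e u v| + #|newly_isolated e u v|).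
Proof.
move=> euv; set R := edge_region e u v.
apply: leq_trans (leq_add (leqnn _) (leq_card_setU _ _)).
apply: leq_trans (leq_card_setU _ _); apply: subset_leq_card.
apply/subsetP => w; rewrite 2!inE => Nw; rewrite in_setU in_setC inE.
case wR: (w \in R); first by rewrite in_setU wR orbT.
rewrite in_setU [_ \in newly_isolated _ _ _]inE -/R wR Nw /=.
have [//|/subsetPn[z Nz zR]] := boolP (N w \subset R); first by rewrite orbT.
rewrite orbF; apply/set0Pn; exists z; move: Nz; rewrite !inE /delete wR => ->.
by [].
Qed.

(** Makes the induction decrease: [u] is deleted, being a neighbour of [v]. *)
Lemma nonisolated_delete_lt u v : e u v ->
  #|~: isolated_vertices (delete (edge_region e u v))| < #|~: isolated_vertices
    e|.
Proof.
move=> euv; apply/proper_card/properP; split.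
  apply/subsetP => y; rewrite !inE; apply: contraNN => /eqP Ny.
  by rewrite -subset0 -Ny neighbors_delete_sub.
exists u; rewrite !inE.
  by apply/set0Pn; exists v; rewrite inE.
by rewrite negbK neighbors_deleted // !inE e_sym euv orbT.
Qed.

(* The vertices of C_5^2 have degree 4, so that no edge leaves a copy of it,
   whence deletions do not create new components of this kind. *)
Lemma C5_2_components_delete R :
  C5_2_components (delete R) \subset C5_2_components e.
Proof.
apply/subsetP => C; rewrite 2!inE =>
  /andP[C_comp /existsP[f /and3P[/injectiveP f_inj /eqP fC f_hom]]].
have f_adj u v : delete R (f u) (f v) = C5_2 u v.
  by have /forallP/(_ u)/forallP/(_ v)/eqP := f_hom.
have C_notin y : y \in C -> exists u, y = f u.
  by rewrite -fC => /imsetP[u _ ->]; exists u.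
have Ne y : y \in C -> N y = neighbors (delete R) y.
  case/C_notin => u ->; apply/esym/eqP; rewrite eqEcard neighbors_delete_sub /=.
  apply: leq_trans (deg_le4 _) _.
  apply: leq_trans (_ : #|f @: [set v | C5_2 u v]| <= _); last first.
    apply/subset_leq_card/subsetP => _ /imsetP[v uv ->]; rewrite inE f_adj.
    by rewrite inE in uv.
  rewrite card_imset //.
  (* The four neighbours of [u] in C_5^2, two in each adjacent class. *)
  pose l := [seq (j, a) | j <- [:: ordS u.1; ord_pred u.1], a <- [:: ord0;
    ord_max : 'I_2]].
  have un_l : uniq l.
    by rewrite /l /= !inE; case: u.1 => [[|[|[|[|[|]]]]] //= ?].
  apply: (@leq_trans #|l|); first by rewrite (card_uniqP un_l).
  apply/subset_leq_card/subsetP => v /allpairsP[[j a] /= [j_u _ ->]].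
  rewrite inE /C5_2 /=; move: j_u; rewrite !inE => /orP[]/eqP->;
    rewrite ?eqxx //.
  by rewrite ord_predK eqxx orbT.
have C_adj y z : y \in C -> e y z = delete R y z.
  by move=> yC; rewrite -!in_neighbors Ne.
have /imsetP[x _ def_C] := C_comp.
have C_conn y : (y \in C) = connect (delete R) x y by rewrite def_C !inE.
have xC : x \in C by rewrite C_conn connect0.
apply/andP; split; last first.
  apply/existsP; exists f; apply/and3P; split; first exact/injectiveP.
    by rewrite fC.
  apply/forallP => u; apply/forallP => v; rewrite C_adj ?f_adj //.
  by rewrite -fC imset_f.
apply/imsetP; exists x => //; apply/setP => y; rewrite C_conn !inE.
apply/idP/idP; first by apply: connect_sub => z t /and3P[ezt _ _];
  apply: connect1.
have cl_C : fingraph.closed e (mem C).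
  apply: (intro_closed (sym_connect_sym e_sym)) => z t ezt zC.
  have zC' : z \in C by [].
  rewrite -[t \in _]/(t \in C) C_conn (@connect_trans _ _ z) -?C_conn //.
  by rewrite connect1 // -C_adj.
by case/andP=> _ /(closed_connect cl_C);
  rewrite -[x \in _]/(x \in C) xC C_conn => <-.
Qed.

End Deletion.

(** * The minimal counterexample *)

Lemma nonisolated_le (T : finType) (e : rel T) :
    symmetric e -> irreflexive e -> (forall y, #|neighbors e y| <= 4) ->
  #|~: isolated_vertices e| <=
    9 * strong_matching_number e + #|C5_2_components e|.
Proof.
have [n] := ubnP #|~: isolated_vertices e|.
elim: n e => // n IH e lt_n e_sym e_irr deg_le4; rewrite leqNgt;
  apply/negP => counter.
have [x0 _] : exists x0, x0 \in ~: isolated_vertices e.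
  by apply/set0Pn; rewrite -card_gt0; apply: leq_ltn_trans counter.
(* The induction hypothesis holds after deleting the region, and the strong matching number has
   dropped by at least one, which frees the constant 9. *)
have loss u v : e u v ->
    9 + #|C5_2_components e| <
      #|C5_2_components (delete e (edge_region e u v))| +
        (#|edge_region e u v| + #|newly_isolated e u v|).
  move=> euv; set e' := delete e _.
  have le_e' : #|~: isolated_vertices e'| <=
      9 * strong_matching_number e' + #|C5_2_components e'|.
    apply: IH; first exact: leq_trans (nonisolated_delete_lt e_sym euv) _.
    - exact: delete_sym.
    - exact: delete_irr.
    by move=> y; apply: leq_trans (subset_leq_card (neighbors_delete_sub _ _
      _)) _.
  have := leq_trans counter (nonisolated_delete euv).
  have := strong_matching_delete e_sym euv; rewrite -/e' => lt_nu lt_c.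
  rewrite -(ltn_add2l (9 * strong_matching_number e')) addnA -mulnSr.
  apply: leq_ltn_trans (_ : 9 * strong_matching_number e + #|C5_2_components e|
    < _).
    by rewrite leq_add2r leq_mul.
  by apply: leq_trans lt_c _; rewrite [leqRHS]addnA leq_add2r.
have loss_ge10 u v : e u v -> 10 <= #|edge_region e u v| + #|newly_isolated e u
  v|.
  move/loss => lt_uv; rewrite -(ltn_add2r #|C5_2_components e|).
  apply: leq_trans lt_uv _; rewrite addnC leq_add2l.
  by rewrite subset_leq_card // C5_2_components_delete.
suff no_edge : forall y, neighbors e y = set0.
  move: counter; apply/negP; rewrite -leqNgt (_ : ~: _ = set0) ?cards0 //.
  by apply/setP => y; rewrite !inE no_edge eqxx.
(* It remains to exclude a component C_5^2. For one of its edges, R and W lie within its 10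
   vertices, while the deletion destroys this component: [loss] would give 9 + c < (c - 1) + 10,
   where c is the number of such components. *)
apply: (@all_isolated _ _ x0 e_sym e_irr deg_le4 loss_ge10) => x x_C5.
have [un_x sz_x _] := x_C5.
set X := [set y in x].
have X_closed := C5_2_closed x_C5; have X_adj := C5_2_adjacent x_C5.
have euv : e (nth x0 x 0) (nth x0 x 2) by rewrite X_adj.
have X_i i : i < 10 -> nth x0 x i \in X by move=> lt_i;
  rewrite inE mem_nth ?sz_x.
have := loss _ _ euv; set R := edge_region _ _ _.
have R_X : R \subset X.
  apply/subsetP => y; rewrite in_setU !in_neighbors.
  by case/orP; apply: X_closed; apply: X_i.
have card_X : #|X| = 10 by rewrite cardsE (card_uniqP un_x) sz_x.
have RW_X : #|R| + #|newly_isolated e (nth x0 x 0) (nth x0 x 2)| <= 10.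
  rewrite -card_X -leq_subRL ?subset_leq_card // -cardsDS //.
  apply/subset_leq_card/subsetP => w; rewrite inE in_setD =>
    /and3P[-> /set0Pn[y Nwy] /subsetP NwR].
  by apply: (X_closed y); [apply/(subsetP R_X)/NwR | rewrite e_sym
    -in_neighbors].
have X_comp := C5_2_component e_sym x_C5.
have lt_comp : #|C5_2_components (delete e R)| < #|C5_2_components e|.
  apply/proper_card/properP; split; first exact: C5_2_components_delete.
  exists X => //; rewrite inE; apply/negP =>
    /andP[_ /existsP[f /and3P[_ /eqP fX /forallP f_hom]]].
  (* Vertex 0 lies in R and is isolated by the deletion, but in a copy of C_5^2 it would have the
     neighbour [(ordS u.1, u.2)]. *)
  have /imsetP[u _ def_u] : nth x0 x 0 \in f @: setT by rewrite fX X_i.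
  have /forallP/(_ (ordS u.1, u.2))/eqP := f_hom u.
  rewrite -def_u /C5_2 /= eqxx -in_neighbors neighbors_deleted ?inE //.
  by rewrite e_sym euv orbT.
apply/negP; rewrite -leqNgt; apply: leq_trans (leq_add (leqnn _) RW_X) _.
by rewrite addnC -[10]/(9.+1) addSnnS leq_add2l.
Qed.

Import GRing.Theory Num.Theory.

Theorem theorem1 (T : finType) (e : rel T)
    (e_sym : symmetric e) (e_irr : irreflexive e)
    (max_deg_le4 : max_degree e <= 4) :
  ((#|T|%:R - #|isolated_vertices e|%:R - #|C5_2_components e|%:R) / 9%:R
     <= (strong_matching_number e)%:R :> rat)%R.
Proof.
have deg_le4 y : #|neighbors e y| <= 4.
  exact: leq_trans (leq_bigmax y) max_deg_le4.
rewrite ler_pdivrMr ?ltr0n // lerBlDr lerBlDr -natrM -!natrD ler_nat.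
(* Cancelling i(G) leaves the number of non-isolated vertices, a bound free of subtraction. *)
rewrite -(cardsC (isolated_vertices e)) addnC leq_add2r mulnC.
exact: nonisolated_le.
Qed.
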